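(* Let $n\ge1$. For any integer $K\ge1$ and any $\alpha>0$ there exist closed convex proper functions $f,g:\mathbb{R}^n\to\mathbb{R}\cup\{+\infty\}$ and a $\frac1\alpha$-smooth convex function $h:\mathbb{R}^n\to\mathbb{R}$, for which there are $x^\star,u^\star\in\mathbb{R}^n$ with $0\in\partial f(x^\star)+\nabla h(x^\star)+u^\star$ and $0\in\partial g^*(u^\star)-x^\star$, and points $x^0,u^0\in\mathbb{R}^n$, $x\in\mathrm{dom}\, f$, $u\in\mathrm{dom}\, g^*$ such that $\|x^0-x\|^2+\alpha^2\|u^0-u\|^2=1$ and $$\mathcal{L}(\bar x^K,u)-\mathcal{L}(x,\bar u^K)>\frac{1}{\alpha(K+1)}\left(\|x^0-x\|^2+\alpha^2\|u^0-u\|^2\right),$$ where $\bar x^K=\frac1K\sum_{k=1}^K x^k$, $\bar u^K=\frac1K\sum_{k=1}^K u^k$, and $\{(x^k,u^k)\}_{k\ge0}$ is generated from $(x^0,u^0)$ by $$u^{k+1}=\mathrm{prox}_{\alpha^{-1}g^*}\big(u^k+\tfrac1\alpha x^k\big),\qquad x^{k+1}=\mathrm{prox}_{\alpha f}\Big(x^k-\alpha(2u^{k+1}-u^k)-\alpha\nabla h\big(x^k+\alpha(u^k-u^{k+1})\big)\Big),\qquad k=0,1,2,\dots$$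
   Context: $\langle\cdot,\cdot\rangle$ and $\|\cdot\|$ are the standard inner product and Euclidean norm on $\mathbb{R}^n$. $h$ is $L$-smooth if it is differentiable with $L$-Lipschitz gradient. $g^*(y)=\sup_x\{\langle y,x\rangle-g(x)\}$ is the Fenchel conjugate, $\partial$ the convex subdifferential, and $\mathrm{prox}_\varphi(x)=\arg\min_{y}\{\varphi(y)+\frac12\|y-x\|^2\}$. The Lagrangian is $\mathcal{L}(x,u)=f(x)+h(x)+\langle u,x\rangle-g^*(u)$. The iteration is the Davis--Yin splitting algorithm (variant DYS-$gf$) for minimizing $f+g+h$. *)

(* Defs.v *)
From mathcomp Require Import all_boot all_order all_algebra.
From mathcomp Require Import all_classical all_reals all_analysis.

Set Implicit Arguments.
Unset Strict Implicit.
Unset Printing Implicit Defensive.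

Import Order.TTheory GRing.Theory Num.Theory.
Import numFieldNormedType.Exports.

Local Open Scope classical_set_scope.
Local Open Scope ring_scope.

Definition dotv (R : realType) (n : nat) (x y : 'rV[R]_n) : R :=
  \sum_(i < n) x ord0 i * y ord0 i.

(* The library norm `|x| on 'rV[R]_n is the sup norm: it is used below only
   through the topology and differentiability, which do not depend on the
   choice of norm. All metric quantities use this Euclidean norm. *)
Definition enorm (R : realType) (n : nat) (x : 'rV[R]_n) : R :=
  Num.sqrt (dotv x x).

Section ConvexAnalysis.
Variables (R : realType) (n : nat).
Local Notation E := 'rV[R]_n.
Implicit Types (f g : E -> \bar R) (h : E -> R) (x y u : E).

(* R^o is R as a module over itself, so that E * R^o is an lmodType R. *)
Definition epi f : set (E * R^o) := [set p | (f p.1 <= (p.2 : R)%:E)%E].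

Definition dom f : set E := [set x | (f x < +oo)%E].

Definition proper_fun f : Prop := (forall x, f x != -oo%E) /\ dom f !=set0.

Definition closed_convex_proper f : Prop :=
  [/\ closed (epi f), convex_set (epi f) & proper_fun f].

Definition grad h x : E := \row_i 'd h x (delta_mx ord0 i).

Definition smooth (L : R) h : Prop :=
  (forall x, differentiable h x) /\
  (forall x y, enorm (grad h x - grad h y) <= L * enorm (x - y)).

Definition fenchel_conj g (y : E) : \bar R :=
  ereal_sup [set ((dotv y x)%:E - g x)%E | x in setT].

(* For proper f this is empty outside dom f. *)
Definition subdiff f x : set E :=
  [set v | forall y, (f x + (dotv v (y - x))%:E <= f y)%E].

Definition argmin (phi : E -> \bar R) : set E :=
  [set p | forall y, (phi p <= phi y)%E].

(* The set of minimizers, which is a singleton when phi is closed, convex and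
   proper; "p = prox phi z" is rendered as prox phi z = [set p]. *)
Definition prox (phi : E -> \bar R) (z : E) : set E :=
  argmin (fun y => phi y + (2^-1 * enorm (y - z) ^+ 2)%:E)%E.

Definition scalef (c : R) (phi : E -> \bar R) (y : E) : \bar R :=
  (c%:E * phi y)%E.

(* Values in \bar R; the library convention +oo - +oo = -oo is only reached
   when x lies outside dom f and u outside dom (fenchel_conj g). *)
Definition Lagrangian f g h (x u : E) : \bar R :=
  (f x + (h x)%:E + (dotv u x)%:E - fenchel_conj g u)%E.

Definition DYS_gf f g h (alpha : R) (xs us : nat -> E) : Prop :=
  forall k,
    prox (scalef alpha^-1 (fenchel_conj g)) (us k + alpha^-1 *: xs k)
      = [set us k.+1] /\
    prox (scalef alpha f)
      (xs k - alpha *: (2%:R *: us k.+1 - us k)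
       - alpha *: grad h (xs k + alpha *: (us k - us k.+1)))
      = [set xs k.+1].

Definition ergodic_mean (xs : nat -> E) (K : nat) : E :=
  K%:R^-1 *: \sum_(1 <= k < K.+1) xs k.

End ConvexAnalysis.

(* Main.v *)
Require Import Defs.
From mathcomp Require Import all_boot all_order all_algebra.
From mathcomp Require Import all_classical all_reals all_analysis.
From mathcomp Require Import ring lra.

Set Implicit Arguments.
Unset Strict Implicit.
Unset Printing Implicit Defensive.

Import Order.TTheory GRing.Theory Num.Theory.
Import numFieldNormedType.Exports.

Local Open Scope classical_set_scope.
Local Open Scope ring_scope.

(** The example lives on one coordinate axis, spanned by the unit vector [e],
    and the comparison point is [x = u = 0]. Write [lam] for a length unit and
    take
      f(x) = (lam / alpha) (K - 1) max(0, - x_i),  g = indicator of {lam e},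
      h(x) = x_i^2 / (2 alpha),
    so that g*(u) = lam u_i. Because g* is linear, the u-step only adds
    (x^k - lam e) / alpha, and the gradient of h is always evaluated at lam e.
    In units of lam e for x and lam e / alpha for u, the iteration becomes
      u' = u + x - 1,   x' = prox of the hinge (K - 1) max(0, -.) at - u'.
    Started from x = u = (K + 1) / 2 it visits u = K and x = -1, then stays at
    the kink x = 0 while u descends through K - 2, ..., 0 (not at all if K = 1),
    and finally rests at the saddle point x = 1, u = -1.

    Along this orbit, f(mean of x) + g*(mean of u) is already equal to the
    claimed bound: the kink holds x^k at 0, so that s = x + alpha u
    decreases to 0 by steps of lam only (after a first step of 2 lam), and this
    slow decrease makes the ergodic gap large. One iterate, x^1 = - lam e, has
    been pushed to the other side of the kink, so the mean of x is
    - (lam / K) e instead of 0, and h contributes the positive excess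
    h(- (lam / K) e) = lam^2 / (2 alpha K^2).
    The normalization of the initial distance to 1 forces
    lam^2 = 2 / (K + 1)^2.

    [DYS_gf_instance] verifies the orbit: each proximal point is recognized
    through a subgradient at that point ([prox_of_subgradient]), which reduces
    the iteration to the scalar facts [u_profileS] and
    [profile_complementarity]. *)

(** * Euclidean inner product *)

Section EuclideanSpace.
Variables (R : realType) (n : nat).
Implicit Types (x y z : 'rV[R]_n) (a : R) (i : 'I_n).

Lemma dotvDl x y z : dotv (x + y) z = dotv x z + dotv y z.
Proof. by rewrite /dotv -big_split; apply: eq_bigr => i _; rewrite mxE mulrDl. Qed.

Lemma dotvC x y : dotv x y = dotv y x.
Proof. by apply: eq_bigr => i _; rewrite mulrC. Qed.

Lemma dotvNl x y : dotv (- x) y = - dotv x y.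
Proof. by rewrite /dotv -sumrN; apply: eq_bigr => i _; rewrite mxE mulNr. Qed.

Lemma dotvDr x y z : dotv x (y + z) = dotv x y + dotv x z.
Proof. by rewrite !(dotvC x) dotvDl. Qed.

Lemma dotvNr x y : dotv x (- y) = - dotv x y.
Proof. by rewrite !(dotvC x) dotvNl. Qed.

Lemma dotvZl a x y : dotv (a *: x) y = a * dotv x y.
Proof. by rewrite /dotv mulr_sumr; apply: eq_bigr => i _; rewrite mxE mulrA. Qed.

Lemma dotv_delta i y : dotv (delta_mx ord0 i) y = y ord0 i.
Proof.
rewrite /dotv (bigD1 i)//= big1 => [|j /negbTE ji].
  by rewrite mxE !eqxx mul1r addr0.
by rewrite mxE ji mul0r.
Qed.

Lemma dotvv_ge0 x : 0 <= dotv x x.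
Proof. by apply: sumr_ge0 => i _; rewrite -expr2 sqr_ge0. Qed.

Lemma dotvv_eq0 x : (dotv x x == 0) = (x == 0).
Proof.
apply/idP/eqP => [|->]; last first.
  by rewrite /dotv big1// => i _; rewrite mxE mul0r.
rewrite psumr_eq0 => [/allP x0|i _]; last by rewrite -expr2 sqr_ge0.
apply/rowP => i; apply/eqP; rewrite mxE -sqrf_eq0 expr2.
by have := x0 i (mem_index_enum i).
Qed.

Lemma enorm_sq x : enorm x ^+ 2 = dotv x x.
Proof. exact/sqr_sqrtr/dotvv_ge0. Qed.

Lemma enorm_deltaZ a i : enorm (a *: delta_mx ord0 i) = `|a|.
Proof.
by rewrite /enorm dotvZl dotv_delta !mxE !eqxx mulr1 -expr2 sqrtr_sqr.
Qed.

Lemma coord_le_enorm x i : `|x ord0 i| <= enorm x.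
Proof.
rewrite -sqrtr_sqr ler_sqrt ?dotvv_ge0// /dotv (bigD1 i)//= expr2 lerDl.
by apply: sumr_ge0 => j _; rewrite -expr2 sqr_ge0.
Qed.

End EuclideanSpace.

(** * Subgradients, proximal points and conjugates *)

Section ConvexAnalysis.
Variables (R : realType) (n : nat).
Implicit Types (phi : 'rV[R]_n -> \bar R) (x y z p v w : 'rV[R]_n).

(** Adding the quadratic term to the subgradient inequality at [p] leaves a
    margin of half the squared distance to [p], which gives both minimality of
    [p] and uniqueness of the minimizer. *)
Lemma prox_of_subgradient phi z p : phi p \is a fin_num ->
  subdiff phi p (z - p) -> prox phi z = [set p].
Proof.
move=> /fineK; move: (fine _) => a phip sub.
have margin y : ((a + 2^-1 * enorm (p - z) ^+ 2 + 2^-1 * enorm (y - p) ^+ 2)%:E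
    <= phi y + (2^-1 * enorm (y - z) ^+ 2)%:E)%E.
  apply: le_trans (leeD2r _ (sub y)).
  rewrite -phip -!EFinD lee_fin !enorm_sq le_eqVlt; apply/orP; left; apply/eqP.
  rewrite !(dotvDl, dotvDr, dotvNl, dotvNr) (dotvC p y) (dotvC z y) (dotvC z p).
  by field.
apply/seteqP; split => [q qmin|_ ->] /=; last first.
  move=> y; apply: le_trans (margin y).
  by rewrite -phip -EFinD lee_fin lerDl enorm_sq mulr_ge0// dotvv_ge0.
have /(le_trans (margin q)) := qmin p.
rewrite -phip -EFinD lee_fin gerDl enorm_sq pmulr_rle0// => qp.
by apply/eqP; rewrite -subr_eq0 -dotvv_eq0 eq_le qp dotvv_ge0.
Qed.

Lemma subdiff_scale (a : R) phi p v : 0 <= a -> phi p \is a fin_num ->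
  subdiff phi p v -> subdiff (scalef a phi) p (a *: v).
Proof.
move=> a0 /fineK; move: (fine _) => b phip sub y; rewrite /scalef dotvZl.
have a0E : (0 <= a%:E)%E by rewrite lee_fin.
apply: le_trans (lee_wpmul2l a0E (sub y)).
by rewrite -phip -!EFinD -!EFinM lee_fin mulrDr.
Qed.

Lemma closed_convex_proper_EFin (phi : 'rV[R]_n -> R) :
  continuous phi -> convex_function setT phi ->
  closed_convex_proper (EFin \o phi).
Proof.
move=> phic phicvx; split.
- rewrite (_ : epi _ = (fun q : 'rV[R]_n * R^o => (q.2 : R) - phi q.1) @^-1`
      [set r : R | 0 <= r]); last first.
    by apply/seteqP; split => q; rewrite /epi /= lee_fin subr_ge0.
  apply: (preimage_closed _ (@closed_ge R 0)).
  move=> q _; apply: cvgB; first exact: cvg_snd.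
  by apply: continuous_comp; [exact: cvg_fst|exact: phic].
- move=> p q t; rewrite !inE /epi /= !lee_fin => pe qe.
  apply: le_trans (phicvx t p.1 q.1 _ _) _; rewrite ?inE//.
  have t0 : 0 <= t%:num by [].
  have t1 : 0 <= 1 - t%:num by rewrite subr_ge0 le1.
  have := lerD (ler_wpM2l t0 pe) (ler_wpM2l t1 qe).
  exact.
- by split=> //; exists 0; rewrite /dom/= ltry.
Qed.

Definition indic_point w x : \bar R := if x == w then 0%E else +oo%E.

Lemma closed_convex_proper_indic_point w : closed_convex_proper (indic_point w).
Proof.
have epiE : epi (indic_point w) =
    (fst @^-1` [set w]) `&` (snd @^-1` [set r : R | 0 <= r]).
  apply/seteqP; split => q; rewrite /epi /indic_point /=.
    by case: eqP => [->|_]; rewrite ?lee_fin.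
  by case=> -> q0; rewrite eqxx lee_fin.
split.
- rewrite epiE; apply: closedI.
  + apply: preimage_closed.
      by move=> q _; exact: cvg_fst.
    exact/accessible_closed_set1/hausdorff_accessible/norm_hausdorff.
  + apply: (preimage_closed _ (@closed_ge R 0)) => q _; exact: cvg_snd.
- move=> p q t; rewrite !inE epiE /= => -[-> p0] [-> q0]; split.
  + by rewrite -scalerDl unstable.add_onemK scale1r.
  + have t0 : 0 <= t%:num by [].
    have t1 : 0 <= 1 - t%:num by rewrite subr_ge0 le1.
    have := addr_ge0 (mulr_ge0 t0 p0) (mulr_ge0 t1 q0).
    exact.
- split=> [x|]; first by rewrite /indic_point; case: ifP.
  by exists w; rewrite /dom /indic_point /= eqxx ltry.
Qed.

(** The supremum defining the conjugate has a single finite competitor. *)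
Lemma fenchel_conj_indic_point w :
  fenchel_conj (indic_point w) = fun u => (dotv u w)%:E.
Proof.
apply/funext => u; apply/eqP; rewrite eq_le; apply/andP; split.
  apply: ge_ereal_sup => _ [x _ <-]; rewrite /indic_point.
  by case: eqP => [->|_]; rewrite ?sube0// addeNy leNye.
by apply: ereal_sup_ubound; exists w => //; rewrite /indic_point eqxx sube0.
Qed.

Lemma subdiff_linear u w : subdiff (fun u => (dotv u w)%:E) u w.
Proof.
move=> y; rewrite -EFinD lee_fin (dotvC w) dotvDl dotvNl.
by rewrite addrC subrK.
Qed.

End ConvexAnalysis.

(** * Convex functions of one coordinate *)

Section Coordinate.
Variables (R : realType) (n : nat) (i : 'I_n).
Implicit Types (x y : 'rV[R]_n) (a c q : R).
Local Notation e := (delta_mx ord0 i : 'rV[R]_n).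

Definition hinge c x : R := c * Num.max 0 (- x ord0 i).

Lemma hinge_ge c q y : - c <= q <= 0 -> q * y ord0 i <= hinge c y.
Proof.
move=> /andP[cq q0]; rewrite /hinge.
by case: (leP 0 (- y ord0 i)) => y0; nra.
Qed.

Lemma hinge_convex c : 0 <= c -> convex_function setT (hinge c).
Proof.
move=> c0 t x y _ _; rewrite convRE /hinge /= /conv /= !mxE /unstable.onem.
have t0 : 0 <= t%:num by [].
have t1 : t%:num <= 1 by [].
move: t0 t1; move: t%:num (x _ _) (y _ _) => s a b s0 s1.
have -> (A B : R) : s * (c * A) + (1 - s) * (c * B) = c * (s * A + (1 - s) * B).
  by ring.
rewrite ler_wpM2l// ge_max.
have a0 : 0 <= Num.max 0 (- a) by rewrite le_max lexx.
have b0 : 0 <= Num.max 0 (- b) by rewrite le_max lexx.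
have aa : - a <= Num.max 0 (- a) by rewrite le_max lexx orbT.
have bb : - b <= Num.max 0 (- b) by rewrite le_max lexx orbT.
by apply/andP; split; nra.
Qed.

Lemma hinge_closed c : 0 <= c -> closed_convex_proper (EFin \o hinge c).
Proof.
move=> c0; apply: closed_convex_proper_EFin; last exact: hinge_convex.
move=> x; apply: (@continuousM _ _ (cst c) (cst 0 \max fun y => - y ord0 i)).
  exact: cst_continuous.
apply: continuous_max; first exact: cst_continuous.
apply: (@continuousN _ _ _ (fun y : 'rV[R]_n => y ord0 i)).
exact: coord_continuous.
Qed.

(** [hinge c] is the support function of the segment from [- c] to [0], so
    its subgradients at [x] are the points of that segment where the maximum
    is attained. *)
Lemma subdiff_hinge c q x : - c <= q <= 0 ->
  q * x ord0 i = hinge c x -> subdiff (EFin \o hinge c) x (q *: e).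
Proof.
move=> cq qx y; rewrite /= -EFinD lee_fin dotvZl dotv_delta !mxE -qx mulrBr.
by rewrite addrC subrK; exact: hinge_ge.
Qed.

Definition half_sq a x : R := a / 2 * x ord0 i ^+ 2.

Lemma is_diff_half_sq a x :
  is_diff x (half_sq a) (fun v => a * x ord0 i * v ord0 i).
Proof.
have dx : is_diff x (fun y => y ord0 i : R) (fun v => v ord0 i).
  have @f : {linear 'rV[R]_n -> R}.
    by exists (fun y => y ord0 i); do 2![eexists]; do ?[constructor];
       rewrite ?mxE// => ? *; rewrite ?mxE//; move=> ?; rewrite !mxE.
  apply: DiffDef; first exact: differentiable_coord.
  by rewrite (_ : (fun _ => _) = f) // diff_lin //; exact: coord_continuous.
have -> : half_sq a = (a / 2) *: ((fun y => y ord0 i : R) ^+ 2).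
  by apply/funext => y.
apply: is_diff_eq; apply/funext => v.
rewrite -[LHS]/(a / 2 * (2 * x ord0 i ^+ 1 * v ord0 i)).
by field.
Qed.

Lemma grad_half_sq a x : grad (half_sq a) x = (a * x ord0 i) *: e.
Proof.
apply/rowP => j; rewrite !mxE (@diff_val _ _ _ _ _ _ _ (is_diff_half_sq a x)).
by rewrite !mxE eq_sym.
Qed.

Lemma smooth_half_sq a : 0 <= a -> smooth a (half_sq a).
Proof.
move=> a0; split => [x|x y].
  exact: (@ex_diff _ _ _ _ _ _ _ (is_diff_half_sq a x)).
rewrite !grad_half_sq -scalerBl enorm_deltaZ -mulrBr normrM ger0_norm//.
rewrite ler_wpM2l//.
by have := coord_le_enorm (x - y) i; rewrite !mxE.
Qed.

Lemma half_sq_convex a : 0 <= a -> convex_function setT (half_sq a).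
Proof.
move=> a0 t x y _ _; rewrite convRE /half_sq /= /conv /= !mxE /unstable.onem.
have t0 : 0 <= t%:num by [].
have t1 : t%:num <= 1 by [].
move: t0 t1; move: t%:num (x _ _) (y _ _) => s b d s0 s1.
rewrite -subr_ge0.
have -> (p := a / 2) : s * (p * b ^+ 2) + (1 - s) * (p * d ^+ 2)
    - p * (s * b + (1 - s) * d) ^+ 2 = p * (s * (1 - s) * (b - d) ^+ 2) by ring.
have s2 : 0 <= 1 - s by rewrite subr_ge0.
by rewrite mulr_ge0 ?divr_ge0// mulr_ge0 ?sqr_ge0// mulr_ge0.
Qed.

End Coordinate.

(** * The orbit of the extremal example *)

Section Instance.
Variables (R : realType) (m : nat).

(** The x-iterates of the example in units of lam e, with m = K - 1. *)
Definition x_profile (k : nat) : R :=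
  match k with
  | 0 => m.+2%:R / 2
  | 1 => -1
  | j.+2 => if (j < m)%N then 0 else 1
  end.

(** The u-iterates in units of (lam / alpha) e. The drop from entry 1 to
    entry 2 is by two units instead of one because x^1 = -1 enters u^2. *)
Definition u_profile (k : nat) : R :=
  match k with
  | 0 => m.+2%:R / 2
  | 1 => m.+1%:R
  | j.+2 => if (j < m)%N then m%:R - j.+1%:R else -1
  end.

Lemma u_profileS k : u_profile k.+1 = u_profile k + x_profile k - 1.
Proof.
case: k => [|[|j]] /=.
- by rewrite !mulrS; field.
- by case: m => [|m'] /=; rewrite !mulrS; ring.
- case: (ltnP j m) => [jm|mj]; last by rewrite ltnNge leqW//= addNr sub0r.
  case: (ltnP j.+1 m) => [_|mj]; first by rewrite !mulrS; ring.
  have -> : m = j.+1 by apply/eqP; rewrite eqn_leq mj jm.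
  by rewrite subrr addr0 sub0r.
Qed.

(** Optimality condition of the x-step: [q] is the subgradient of the hinge
    that the step selects, and it must attain the maximum defining the hinge
    at the new point. At the kink any [q] in the segment will do, and this is
    what keeps x at 0 while u varies. *)
Lemma profile_complementarity k (q := - (u_profile k.+1 + x_profile k.+1)) :
  - m%:R <= q <= 0 /\ q * x_profile k.+1 = m%:R * Num.max 0 (- x_profile k.+1).
Proof.
rewrite {}/q; case: k => [|j] /=.
  rewrite opprK max_r// -natr1 addrK lexx oppr_le0 ler0n; split=> //.
  by rewrite mulrN1 opprK mulr1.
case: ltnP => [jm|_] /=; last first.
  by rewrite max_l ?oppr_le0// addNr oppr0 mulr0 mul0r lexx oppr_le0 ler0n.
rewrite oppr0 maxxx addr0 !mulr0; split=> //.
by rewrite lerN2 gerBl ler0n oppr_le0 subr_ge0 ler_nat.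
Qed.

Lemma sum_x_profile : \sum_(1 <= k < m.+2) x_profile k = -1.
Proof.
rewrite big_ltn// big_add1 big_add1 /= big_nat big1 ?addr0// => j /andP[_ jm].
by rewrite jm.
Qed.

Lemma sum_u_profile :
  \sum_(1 <= k < m.+2) u_profile k = m.+1%:R + m%:R * (m%:R - 1) / 2.
Proof.
rewrite big_ltn// big_add1 big_add1 /=; congr (_ + _).
rewrite (eq_big_nat _ _ (F2 := fun j => m%:R - j.+1%:R)) => [|j /andP[_ ->]//].
have arith (a : R) p : \sum_(0 <= j < p) (a - j.+1%:R)
    = p%:R * a - p%:R * (p%:R + 1) / 2.
  elim: p => [|p IH]; first by rewrite big_nil; ring.
  by rewrite big_nat_recr//= IH !mulrS; field.
by rewrite arith; field.
Qed.

Variables (n : nat) (i : 'I_n) (alpha lam : R).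
Hypotheses (alpha_gt0 : 0 < alpha) (lam_ge0 : 0 <= lam).
Local Notation e := (delta_mx ord0 i : 'rV[R]_n).
Local Notation f := (EFin \o hinge i (lam / alpha * m%:R)).
Local Notation g := (indic_point (lam *: e)).
Local Notation h := (half_sq i alpha^-1).

Definition dys_x k : 'rV[R]_n := (lam * x_profile k) *: e.
Definition dys_u k : 'rV[R]_n := (lam / alpha * u_profile k) *: e.

Lemma DYS_gf_instance : DYS_gf f g h alpha dys_x dys_u.
Proof.
have alpha_neq0 : alpha != 0 by rewrite gt_eqF.
move=> k; split.
  rewrite fenchel_conj_indic_point; apply: prox_of_subgradient => //.
  (* the u-step uses the constant gradient lam e of the linear function g* *)
  rewrite (_ : _ - _ = alpha^-1 *: (lam *: e)).
    by apply: subdiff_scale; rewrite ?invr_ge0 ?ltW//; exact: subdiff_linear.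
  by rewrite /dys_x /dys_u u_profileS; apply/rowP => j; rewrite !mxE; field.
pose q := - (u_profile k.+1 + x_profile k.+1).
have [/andP[mq q0] qE] := profile_complementarity k.
apply: prox_of_subgradient => //.
(* the gradient of h at lam e moves the argument of the x-step by - lam e *)
rewrite (_ : _ - _ = alpha *: ((lam / alpha * q) *: e)); last first.
  rewrite grad_half_sq /dys_x /dys_u /q u_profileS; apply/rowP => j.
  by rewrite !mxE !eqxx /=; field.
have la0 : 0 <= lam / alpha by rewrite divr_ge0// ltW.
apply: subdiff_scale; rewrite ?ltW//; apply: subdiff_hinge.
  by rewrite -mulrN ler_wpM2l//= mulr_ge0_le0.
rewrite /hinge !mxE !eqxx mulr1 -mulrN -[X in Num.max X _](mulr0 lam).
by rewrite -maxr_pMr// mulrACA qE; ring.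
Qed.

End Instance.

(** * The lower bound *)

Theorem theorem4p3 (R : realType) (n : nat) (hn : (1 <= n)%N)
    (K : nat) (hK : (1 <= K)%N) (alpha : R) (halpha : 0 < alpha) :
  exists (f g : 'rV[R]_n -> \bar R) (h : 'rV[R]_n -> R),
    [/\ closed_convex_proper f, closed_convex_proper g,
        smooth alpha^-1 h, convex_function setT h
      & (exists xstar ustar : 'rV[R]_n,
          [set v + grad h xstar + ustar | v in subdiff f xstar] 0 /\
          [set w - xstar | w in subdiff (fenchel_conj g) ustar] 0) /\
        exists (x0 u0 x u : 'rV[R]_n) (xs us : nat -> 'rV[R]_n),
          [/\ dom f x, dom (fenchel_conj g) u,
              enorm (x0 - x) ^+ 2 + alpha ^+ 2 * enorm (u0 - u) ^+ 2 = 1,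
              [/\ xs 0%N = x0, us 0%N = u0 & DYS_gf f g h alpha xs us]
            & (Lagrangian f g h (ergodic_mean xs K) u
               - Lagrangian f g h x (ergodic_mean us K)
               > ((alpha * K.+1%:R)^-1 *
                  (enorm (x0 - x) ^+ 2 + alpha ^+ 2 * enorm (u0 - u) ^+ 2))%:E)%E]].
Proof.
case: K hK => // m _; pose i := Ordinal hn.
have [lam lam0 lam2] : exists2 l : R, 0 <= l & l ^+ 2 = 2 / m.+2%:R ^+ 2.
  exists (Num.sqrt 2 / m.+2%:R); first by rewrite divr_ge0 ?sqrtr_ge0.
  by rewrite expr_div_n sqr_sqrtr.
have alpha0 : alpha != 0 by rewrite gt_eqF.
have m1 : 1 + m%:R != 0 :> R by rewrite -(natrD _ 1) pnatr_eq0.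
have m2 : 2 + m%:R != 0 :> R by rewrite -(natrD _ 2) pnatr_eq0.
pose e : 'rV[R]_n := delta_mx ord0 i.
pose c := lam / alpha * m%:R.
have c0 : 0 <= c by rewrite !mulr_ge0// invr_ge0 ltW.
exists (EFin \o hinge i c), (indic_point (lam *: e)), (half_sq i alpha^-1).
have ainv0 : 0 <= alpha^-1 by rewrite invr_ge0 ltW.
split.
- exact: hinge_closed.
- exact: closed_convex_proper_indic_point.
- exact: smooth_half_sq.
- exact: half_sq_convex.
split.
  exists (lam *: e), (- (lam / alpha) *: e); split.
    exists 0.
      rewrite -(scale0r e); apply: subdiff_hinge; rewrite ?lexx ?oppr_le0 ?c0//.
      by rewrite /hinge !mxE !eqxx mulr1 max_l ?oppr_le0// mul0r mulr0.
    rewrite grad_half_sq add0r !mxE !eqxx mulr1 -scalerDl (mulrC alpha^-1).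
    by rewrite subrr scale0r.
  rewrite fenchel_conj_indic_point; exists (lam *: e); last exact: subrr.
  exact: subdiff_linear.
exists (dys_x m i lam 0), (dys_u m i alpha lam 0), 0, 0.
exists (dys_x m i lam), (dys_u m i alpha lam).
have D1 : enorm (dys_x m i lam 0 - 0) ^+ 2 +
    alpha ^+ 2 * enorm (dys_u m i alpha lam 0 - 0) ^+ 2 = 1.
  rewrite !subr0 /dys_x /dys_u !enorm_deltaZ !real_normK ?num_real//=.
  by rewrite !exprMn lam2; field; rewrite alpha0 m2.
split => //.
- by rewrite /dom /= ltry.
- by rewrite fenchel_conj_indic_point /dom /= ltry.
- by split=> //; exact: DYS_gf_instance.
have dot0 z : dotv (0 : 'rV[R]_n) z = 0 by rewrite -(scale0r 0) dotvZl mul0r.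
rewrite D1 mulr1 /Lagrangian fenchel_conj_indic_point /ergodic_mean.
have -> : \sum_(1 <= k < m.+2) dys_x m i lam k = - lam *: e.
  by rewrite -scaler_suml -mulr_sumr sum_x_profile mulrN1.
have -> : \sum_(1 <= k < m.+2) dys_u m i alpha lam k =
    (lam / alpha * (m.+1%:R + m%:R * (m%:R - 1) / 2)) *: e.
  by rewrite -scaler_suml -mulr_sumr sum_u_profile.
rewrite /= -!EFinD -?EFinN -?EFinD lte_fin.
rewrite (dotvC _ 0) !dot0 !dotvZl dotvC dotvZl dotv_delta /hinge /half_sq.
rewrite !mxE !eqxx !mulr1 oppr0 maxxx max_r ?mulrN ?opprK ?mulr_ge0//.
(* the excess over the bound is the value of h at the mean of the x-iterates *)
rewrite -subr_gt0 (_ : _ - _ = lam ^+ 2 / (2 * alpha * m.+1%:R ^+ 2)).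
  by rewrite lam2 !(divr_gt0, mulr_gt0, exprn_gt0).
rewrite (_ : (alpha * m.+2%:R)^-1 = lam ^+ 2 * m.+2%:R / (2 * alpha)) /c.
  by field; rewrite alpha0 m1.
by rewrite lam2; field; rewrite alpha0 m2.
Qed.
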